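(* Let $F:\mathbb{R}\to\mathbb{R}$ and $D:\mathbb{R}^2\to\mathbb{R}$ be continuous functions, let $I\subseteq\mathbb{R}$ be an interval, $t_0\in I$, and let $(q,p):I\to\mathbb{R}^2$ be a differentiable solution of $$\dot q = p,\qquad \dot p = F(q)-D(q,p),$$ with initial values $q(t_0)=q_0$, $p(t_0)=p_0$. Let $V(x)=-\int_{q_0}^{x}F(s)\,ds$ and let $w(t)=\int_{t_0}^{t}D(q(s),p(s))\,p(s)\,ds$ be the reservoir variable along this solution. Then the non-potential Hamiltonian $$K=\tfrac12 p^2+V(q)+w$$ is conserved during the time evolution of the system, i.e. $t\mapsto \tfrac12 p(t)^2+V(q(t))+w(t)$ is constant on $I$.
   Context: The system is a one-dimensional autonomous mechanical system with coordinate $q$ and momentum $p$, with potential force $F(q)$ and a non-potential (dissipative) force $D(q,p)$ that does not depend explicitly on time. The reservoir variable $w$ is the work done by the dissipative force along the trajectory, $w(t)=\int_{t_0}^{t}D(q(s),p(s))\,p(s)\,ds$, so that $\dot w=D(q,p)\,p$ and $w(t_0)=0$. The non-potential Hamiltonian is $K=\frac12p^2+V(q)+w$, where $V$ is the potential of $F$. *)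

(* Defs.v *)
From Stdlib Require Import Reals.
From Coquelicot Require Import Coquelicot.
Open Scope R_scope.

(* Order-convex subsets of R: open, closed, half-open, bounded or not.
   The degenerate cases (empty set, single point) are included. *)
Definition is_interval (I : R -> Prop) : Prop :=
  forall x y z : R, I x -> I z -> x <= y <= z -> I y.

(* [D_in f f' I t] is differentiability at t relative to I, so it is one-sided
   at an endpoint belonging to I; only the values of q and p on I matter. *)
Definition is_solution (F : R -> R) (D : R * R -> R) (I : R -> Prop)
    (q p : R -> R) : Prop :=
  forall t : R, I t ->
    D_in q p I t /\ D_in p (fun s => F (q s) - D (q s, p s)) I t.

Definition potential (F : R -> R) (q0 : R) (x : R) : R := - RInt F q0 x.

(* The work of the dissipative force along the trajectory since time t0. *)
Definition reservoir (D : R * R -> R) (q p : R -> R) (t0 t : R) : R :=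
  RInt (fun s => D (q s, p s) * p s) t0 t.

Definition npHamiltonian (F : R -> R) (D : R * R -> R) (q0 t0 : R)
    (q p : R -> R) (t : R) : R :=
  / 2 * p t ^ 2 + potential F q0 (q t) + reservoir D q p t0 t.

(* Main.v *)
(* Differentiating K along the flow gives p (F(q) - D(q,p)) - F(q) p + D(q,p) p = 0,
   so K is constant by the mean value theorem. As the solution is only controlled
   on I, q and p are precomposed with the projection of R onto the compact interval
   between t0 and t: this makes them continuous on all of R, with the same
   derivatives inside the interval. *)
Require Import Defs.
From Stdlib Require Import Reals Lra.
From Coquelicot Require Import Coquelicot.
Open Scope R_scope.

Definition clamp (a b x : R) : R := Rmax a (Rmin b x).

Lemma clamp_id (a b x : R) : a <= x <= b -> clamp a b x = x.
Proof.
  intros [ax xb]; unfold clamp.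
  now rewrite Rmin_right, Rmax_right.
Qed.

Lemma clamp_bounds (a b x : R) : a <= b -> a <= clamp a b x <= b.
Proof.
  unfold clamp, Rmax, Rmin; intros.
  destruct (Rle_dec b x); destruct (Rle_dec a _); lra.
Qed.

Lemma clamp_lipschitz (a b x y : R) :
  a <= b -> Rabs (clamp a b y - clamp a b x) <= Rabs (y - x).
Proof.
  intros ab; unfold clamp, Rmax, Rmin.
  destruct (Rle_dec b x); destruct (Rle_dec b y);
    repeat destruct (Rle_dec a _);
    unfold Rabs; repeat destruct (Rcase_abs _); lra.
Qed.

(** Differentiability relative to [I] gives continuity relative to [I] at [clamp a b x]; as [clamp]
    is 1-Lipschitz, the same [alp] serves at [x]. *)
Lemma D_in_clamp_continuous (f d : R -> R) (I : R -> Prop) (a b : R) :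
  a <= b -> (forall x, a <= x <= b -> I x) ->
  (forall x, I x -> D_in f d I x) ->
  forall x, continuous (fun s => f (clamp a b s)) x.
Proof.
  intros ab sub der x.
  apply continuity_pt_filterlim.
  intros eps eps0.
  destruct (cont_deriv _ _ _ _ (der _ (sub _ (clamp_bounds a b x ab))) eps eps0)
    as [alp [alp0 close]].
  exists alp; split; [exact alp0|].
  intros y [_ xy]; simpl in *; unfold Rdist in *.
  (* The limit behind [D_in] excludes its base point, yet distinct points outside the interval may
     be clamped to the same value. *)
  destruct (Req_dec (clamp a b x) (clamp a b y)) as [e|ne].
  - rewrite e, Rminus_diag, Rabs_R0; exact eps0.
  - apply close; repeat split.
    + apply sub, clamp_bounds, ab.
    + exact ne.
    + eapply Rle_lt_trans; [apply clamp_lipschitz, ab | exact xy].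
Qed.

(** Increments shorter than the distance from [x] to both endpoints stay where [clamp] is the
    identity, so the difference quotients agree with those of [f]. *)
Lemma D_in_clamp_is_derive (f d : R -> R) (I : R -> Prop) (a b x : R) :
  (forall y, a <= y <= b -> I y) -> a < x < b -> D_in f d I x ->
  is_derive (fun s => f (clamp a b s)) x (d x).
Proof.
  intros sub [ax xb] der.
  apply is_derive_Reals; intros eps eps0.
  destruct (der eps eps0) as [alp [alp0 close]].
  assert (r0 : 0 < Rmin alp (Rmin (x - a) (b - x)))
    by (repeat apply Rmin_glb_lt; lra).
  exists (mkposreal _ r0); simpl; intros h h0 hr.
  pose proof (Rmin_l alp (Rmin (x - a) (b - x))).
  pose proof (Rmin_r alp (Rmin (x - a) (b - x))).
  pose proof (Rmin_l (x - a) (b - x)).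
  pose proof (Rmin_r (x - a) (b - x)).
  assert (hb : - (Rmin (x - a) (b - x)) < h < Rmin (x - a) (b - x))
    by (apply Rabs_def2 in hr; lra).
  rewrite !clamp_id by lra.
  simpl in close; unfold Rdist in close.
  (* This turns the denominator into the form used by [D_in]. *)
  replace h with (x + h - x) at 2 by ring.
  apply close; repeat split.
  - apply sub; lra.
  - lra.
  - replace (x + h - x) with h by ring; lra.
Qed.

Lemma is_derive_RInt_continuous (f : R -> R) (a x : R) :
  (forall y, continuous f y) -> is_derive (fun y => RInt f a y) x (f x).
Proof.
  intros fc; apply is_derive_RInt with a; [|apply fc].
  apply filter_forall; intros y.
  apply (RInt_correct (V := R_CompleteNormedModule)), ex_RInt_continuous; auto.
Qed.

(** The equations of motion are asked only strictly between [t0] and [t], because clamped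
    trajectories may have corners at the two ends; the mean value theorem needs no more than
    continuity there. *)
Lemma npHamiltonian_conserved (F : R -> R) (D : R * R -> R) (q p : R -> R)
    (q0 t0 t : R) :
  (forall x, continuous F x) -> (forall z, continuous D z) ->
  (forall s, continuous q s) -> (forall s, continuous p s) ->
  (forall s, Rmin t0 t < s < Rmax t0 t ->
    is_derive q s (p s) /\ is_derive p s (F (q s) - D (q s, p s))) ->
  npHamiltonian F D q0 t0 q p t = npHamiltonian F D q0 t0 q p t0.
Proof.
  intros Fc Dc qc pc der.
  assert (gc : forall s, continuous (fun s => D (q s, p s) * p s) s).
  { intros s; apply (continuous_mult (fun s => D (q s, p s)) p); [|apply pc].
    apply (continuous_comp_2 q p (fun x y => D (x, y))); auto.
    (* [D] takes a pair, so it agrees with its curried and re-paired form only after the pair is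
       destructed. *)
    eapply continuous_ext; [|apply Dc]; now intros []. }
  assert (Vd := fun x => is_derive_RInt_continuous F q0 x Fc).
  assert (wd := fun x => is_derive_RInt_continuous _ t0 x gc).
  destruct (MVT_gen (npHamiltonian F D q0 t0 q p) t0 t (fun _ => 0))
    as [c [_ E]]; [| |lra].
  - intros s st; destruct (der s st) as [qd pd].
    assert (Vqd := is_derive_comp _ q s _ _ (Vd (q s)) qd).
    assert (ppd := is_derive_scal _ s (/ 2) _ (is_derive_pow p 2 s _ pd)).
    assert (Kd := is_derive_plus _ _ s _ _
      (is_derive_plus _ _ s _ _ ppd (is_derive_opp _ s _ Vqd)) (wd s)).
    (* [l] is the derivative as assembled by the sum, power and chain rules; its terms cancel
       algebraically. *)
    match type of Kd with is_derive _ _ ?l => replace 0 with l end.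
    + exact Kd.
    + unfold plus, opp, scal; simpl; unfold mult; simpl; field.
  - intros s _; apply continuity_pt_filterlim.
    apply (continuous_plus (fun s => / 2 * p s ^ 2 + potential F q0 (q s))).
    + apply (continuous_plus (fun s => / 2 * p s ^ 2)).
      * apply (continuous_comp p (fun y => / 2 * y ^ 2)); [apply pc|].
        apply (ex_derive_continuous (V := R_NormedModule)); auto_derive; trivial.
      * apply (continuous_comp q (potential F q0)); [apply qc|].
        apply (continuous_opp (V := R_NormedModule)).
        apply (ex_derive_continuous (V := R_NormedModule)).
        eexists; apply Vd.
    + apply (ex_derive_continuous (V := R_NormedModule)); eexists; apply wd.
Qed.

Theorem theorem3p1 (F : R -> R) (D : R * R -> R) (I : R -> Prop)
    (q p : R -> R) (t0 q0 p0 : R)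
    (F_cont : forall x : R, continuous F x)
    (D_cont : forall z : R * R, continuous D z)
    (I_itv : is_interval I) (I_t0 : I t0)
    (sol : is_solution F D I q p)
    (q_init : q t0 = q0) (p_init : p t0 = p0) :
  forall t1 t2 : R, I t1 -> I t2 ->
    npHamiltonian F D q0 t0 q p t1 = npHamiltonian F D q0 t0 q p t2.
Proof.
  enough (conserved : forall t, I t ->
      npHamiltonian F D q0 t0 q p t = npHamiltonian F D q0 t0 q p t0)
    by (intros t1 t2 It1 It2; now rewrite (conserved t1 It1), (conserved t2 It2)).
  intros t It.
  assert (ab := Rminmax t0 t).
  assert (sub : forall s, Rmin t0 t <= s <= Rmax t0 t -> I s).
  { intros s st; apply (I_itv (Rmin t0 t) s (Rmax t0 t)); [| |exact st].
    - now apply Rmin_case.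
    - now apply Rmax_case. }
  set (c := clamp (Rmin t0 t) (Rmax t0 t)).
  assert (c_id : forall s, Rmin t0 t <= s <= Rmax t0 t -> c s = s)
    by (intros; now apply clamp_id).
  (* At [s] the Hamiltonian sees the trajectory only at [s] and, through the work integral, between
     [t0] and [s]; clamping changes nothing there. *)
  assert (clamped : forall s, Rmin t0 t <= s <= Rmax t0 t ->
    npHamiltonian F D q0 t0 q p s =
    npHamiltonian F D q0 t0 (fun s => q (c s)) (fun s => p (c s)) s).
  { intros s [s1 s2]; unfold npHamiltonian, reservoir.
    rewrite (c_id s) by lra; f_equal.
    apply RInt_ext; intros u [u1 u2].
    rewrite c_id; [reflexivity|split].
    - eapply Rle_trans; [|apply Rlt_le, u1].
      apply Rmin_glb; [apply Rmin_l | exact s1].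
    - eapply Rle_trans; [apply Rlt_le, u2|].
      apply Rmax_lub; [apply Rmax_l | exact s2]. }
  (* Both [t] and [t0] are endpoints of the clamping interval. *)
  rewrite !clamped by
    (split; auto using Rmin_l, Rmin_r, Rmax_l, Rmax_r).
  apply npHamiltonian_conserved; auto.
  - apply (D_in_clamp_continuous q p I); auto.
    intros; now apply sol.
  - apply (D_in_clamp_continuous p (fun s => F (q s) - D (q s, p s)) I); auto.
    intros; now apply sol.
  - intros s st; rewrite !c_id by lra.
    destruct (sol s) as [qd pd]; [apply sub; lra|].
    split.
    + now apply (D_in_clamp_is_derive q p I).
    + now apply (D_in_clamp_is_derive p (fun s => F (q s) - D (q s, p s)) I).
Qed.
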